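(* Let $L\ge2$ and $N\ge1$ be integers and assume that the random vector $X=(X_1,\dots,X_L)$ follows the Bose-Einstein statistics with $L$ sites and $N$ particles. Denote by $\gamma_L^N\in\mathcal{P}(\mathbb{Z}_+^2)$ the distribution of $(X_1,X_2)$ and let $\lambda^{N/L}\in\mathcal{P}(\mathbb{Z}_+)$ be the geometric distribution with support $\mathbb{Z}_+$ and parameter $1/(1+N/L)$: $$\lambda^{N/L}(\{k\}):=\frac{1}{1+N/L}\Big(1-\frac{1}{1+N/L}\Big)^k,\qquad k\in\mathbb{Z}_+.$$ Then $$\Vert\gamma_L^N-\lambda^{N/L}\otimes\lambda^{N/L}\Vert\le\frac{14N}{L^2}.$$
   Context: $\mathbb{Z}_+$ is the set of non-negative integers. $\mathcal{P}(S)$ is the set of probability measures on a denumerable set $S$, endowed with the total variation distance $\Vert p-q\Vert:=\sup_{A\subseteq S}(p(A)-q(A))=\frac12\sum_{s\in S}|p(\{s\})-q(\{s\})|$. $X=(X_1,\dots,X_L)$ follows the Bose-Einstein statistics with $L$ sites and $N$ particles if $\mathbb{P}(X_1=x_1,\dots,X_L=x_L)=1/\binom{L+N-1}{N}$ when $(x_1,\dots,x_L)\in\mathbb{Z}_+^L$ and $\sum_{k=1}^L x_k=N$, and $0$ otherwise. *)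

(* Defs.v *)
From HB Require Import structures.
From mathcomp Require Import all_boot all_order all_algebra.
From mathcomp Require Import all_classical all_reals all_analysis.

Set Implicit Arguments.
Unset Strict Implicit.
Unset Printing Implicit Defensive.

Import Order.TTheory GRing.Theory Num.Theory.
Import numFieldNormedType.Exports.

Local Open Scope classical_set_scope.
Local Open Scope ring_scope.

(* The supremum is over all subsets; this is the usual total variation distance
   when every subset of T is measurable, in particular for nat and nat * nat. *)
Definition tv_dist {d} {T : measurableType d} {R : realType}
    (p q : probability T R) : \bar R :=
  ereal_sup [set (p A - q A)%E | A in [set: set T]].

Definition geometric_pmf {R : realType} (p : R) (k : nat) : R :=
  p * (1 - p) ^+ k.

(* The Dirac mass is a default value for parameters outside of ]0, 1]; it makes
   geometric_prob p a probability measure for every p. *)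
Definition geometric_prob {R : realType} (p : R) : set nat -> \bar R :=
  fun U => if 0 < p <= 1 then \esum_(k in U) (geometric_pmf p k)%:E
           else \d_0%N U.

Section geometric_probability.
Context {R : realType} (p : R).
Local Open Scope ereal_scope.

Local Notation geom := (geometric_prob p).

Let pmf_ge0 k : (0 < p <= 1)%R -> 0 <= (geometric_pmf p k)%:E.
Proof.
by move=> /andP[p0 p1]; rewrite lee_fin mulr_ge0 ?exprn_ge0 ?subr_ge0// ltW.
Qed.

Let geometric0 : geom set0 = 0.
Proof.
by rewrite /geometric_prob measure0; case: ifPn => //; rewrite esum_set0.
Qed.

Let geometric_ge0 U : 0 <= geom U.
Proof.
by rewrite /geometric_prob; case: ifPn => // p01; apply: esum_ge0 => k _;
  exact: pmf_ge0.
Qed.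

Let geometric_sigma_additive : semi_sigma_additive geom.
Proof.
move=> F mF tF mUF; rewrite /geometric_prob; case: ifPn => p01; last first.
  exact: measure_semi_sigma_additive.
apply: cvg_toP.
  apply: ereal_nondecreasing_is_cvgn => a b ab.
  apply: lee_sum_nneg_natr => // n _ _.
  by apply: esum_ge0 => /= k _; exact: pmf_ge0.
by rewrite nneseries_sum_bigcup// => k; exact: pmf_ge0.
Qed.

HB.instance Definition _ := isMeasure.Build _ _ _ geom
  geometric0 geometric_ge0 geometric_sigma_additive.

Let geometric_setT : geom [set: nat] = 1.
Proof.
rewrite /geometric_prob; case: ifPn => [p01|_]; last by rewrite probability_setT.
rewrite -nneseries_esumT; last by move=> k; exact: pmf_ge0.
have /andP[p0 p1] := p01.
have q1 : (`|1 - p| < 1)%R by rewrite ger0_norm ?subr_ge0// ltrBlDr ltrDl.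
have /(cvg_lim (@Rhausdorff R)) := @cvg_geometric_series R p _ q1.
rewrite subKr divff ?gt_eqF// => geom_lim.
rewrite -geom_lim -EFin_lim; last exact: is_cvg_geometric_series.
by apply/congr_lim/funext => n /=; rewrite sumEFin.
Qed.

HB.instance Definition _ :=
  @Measure_isProbability.Build _ _ R geom geometric_setT.

End geometric_probability.

Definition bose_einstein {d} {T : measurableType d} {R : realType}
    (P : probability T R) (L N : nat) (X : {RV P >-> L.-tuple nat}) : Prop :=
  forall x : L.-tuple nat,
    distribution P X [set x] =
    (if (\sum_(i < L) tnth x i == N)%N then ('C(L + N - 1, N)%:R : R)^-1
     else 0)%:E.
Arguments bose_einstein {d T R} P {L} N X.

Definition coord_pair {d} {T : measurableType d} {L : nat}
    (X : {mfun T >-> L.-tuple nat}) (i j : 'I_L) : T -> nat * nat :=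
  fun w => (tnth (X w) i, tnth (X w) j).

Section coord_pair_measurable.
Context {d} {T : measurableType d} {L : nat}.
Context (X : {mfun T >-> L.-tuple nat}) (i j : 'I_L).

Let measurable_coord_pair : measurable_fun [set: T] (coord_pair X i j).
Proof.
by apply: measurable_fun_pair; apply: (measurableT_comp (measurable_tnth _)) => //;
  exact: measurable_funPT.
Qed.

HB.instance Definition _ :=
  isMeasurableFun.Build _ _ _ _ (coord_pair X i j) measurable_coord_pair.

End coord_pair_measurable.

(* Main.v *)
Require Import Defs.
From HB Require Import structures.
From mathcomp Require Import all_boot all_order all_algebra.
From mathcomp Require Import all_classical all_reals all_analysis.
From mathcomp Require Import ring lra zify.

Set Implicit Arguments.
Unset Strict Implicit.
Unset Printing Implicit Defensive.

Import Order.TTheory GRing.Theory Num.Theory.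
Import numFieldNormedType.Exports.

Local Open Scope classical_set_scope.
Local Open Scope ring_scope.

(** Both laws give to (i, j) a mass that depends on k = i + j only: the law of
    (X_1, X_2) gives w k, by stars and bars (the remaining L - 2 sites share
    N - k particles), and the product of geometric laws gives
    g k = (L / (L + N))^2 (N / (L + N))^k.

    The total variation distance is the mass of the positive part of the
    difference. At k = 0 this positive part vanishes, since w 0 <= g 0
    (pair_pmf0_le). Elsewhere the relative excess is of order 1 / L: the bound
    (1 - 7 / L) w k <= g k (pair_pmf_le) makes the positive part at most
    (7 / L) w k. Since the sites 1 and 2 are both empty except with
    probability at most 2 N / L (pair_pmf0_ge), the distance is at most
    (7 / L) (2 N / L) = 14 N / L^2; tv_dist_le is this argument for
    general laws.

    The heart of the matter is pair_pmf_le. The quotient g k / w k is a product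
    of explicit factors, and the factor of index i is at least 1 - b i / (L + N)
    with b i = max (0, 3 - (L - 3) i / N). Hence g k / w k is at least
    1 - (b 0 + ... + b (k - 1)) / (L + N) (le_geometric_pair_pmf), and this sum of
    positive parts of a decreasing arithmetic progression is bounded
    uniformly in k by comparison with the integral of the progression
    (sum_max0_arith).

    If 14 N >= L^2 then the bound is at least 1 and there is nothing to prove.
    This disposes of L = 2, where the law of (X_1, X_2) has a different form. *)

(** * The mass function of two sites *)

(** For m + 3 sites and N particles, this is the probability that the sites 1
    and 2 hold i and j particles, whenever i + j = k <= N. Writing the number
    of sites as m + 3 keeps the subtractions of natural numbers exact. *)
Definition pair_pmf {R : realFieldType} (m N k : nat) : R :=
  'C(m + (N - k), m)%:R / 'C(m.+2 + N, m.+2)%:R.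

Lemma pair_pmf_ge0 (R : realFieldType) m N k : 0 <= pair_pmf m N k :> R.
Proof. by rewrite divr_ge0. Qed.

Lemma pair_pmfS (R : realFieldType) m N k : (k < N)%N ->
  (m%:R + N%:R - k%:R) * pair_pmf m N k.+1 = (N%:R - k%:R) * pair_pmf m N k :> R.
Proof.
move=> kN; rewrite /pair_pmf !mulrA; congr (_ / _).
rewrite -addrA -natrB 1?ltnW// -natrD -!natrM; congr _%:R.
have := mul_bin_down (m + (N - k)) m.
by rewrite addKn => <-; congr (_ * 'C(_, _))%N; lia.
Qed.

Lemma pair_pmf0 (R : realFieldType) m N :
  (m%:R + 2 + N%:R) * (m%:R + 1 + N%:R) * pair_pmf m N 0 =
  (m%:R + 2) * (m%:R + 1) :> R.
Proof.
rewrite /pair_pmf subn0.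
have C0 : 'C(m.+2 + N, m.+2)%:R != 0 :> R by rewrite pnatr_eq0 -lt0n bin_gt0 leq_addr.
rewrite mulrA; apply: (mulIf C0); rewrite mulfVK//.
have E1 := mul_bin_diag (m.+1 + N) m.
have E2 := mul_bin_diag (m.+2 + N) m.+1.
have E3 : ((m + 2 + N) * (m + 1 + N) * 'C(m + N, m) =
  (m + 2) * (m + 1) * 'C(m.+2 + N, m.+2))%N.
  by rewrite !addn2 !addn1 -mulnA E1 mulnCA E2 mulnA [(m.+1 * _)%N]mulnC.
by move/(congr1 (GRing.natmul (1 : R))) : E3; rewrite !natrM !natrD.
Qed.

(** The quotient of consecutive quotients g / w is
    (N / (L + N)) ((m + N - k) / (N - k)), and it exceeds
    1 - (3 - m k / N) / (L + N) by m k^2 / (N (N - k) (L + N)). Truncating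
    3 - m k / N at 0 is what allows the product of the factors to be
    bounded below by one minus a sum, as the terms must be nonnegative. *)
Lemma le_geometric_pair_pmf (R : realFieldType) (m N k : nat) :
  let l : R := m.+3%:R in let n : R := N%:R in
  let F j := \sum_(0 <= i < j) Num.max 0 (3 - m%:R * i%:R / n) in
  (k <= N)%N ->
  (1 - F k / (l + n)) * pair_pmf m N k <=
    (l / (l + n)) ^+ 2 * (n / (l + n)) ^+ k.
Proof.
move=> l n F; have -> : l = m%:R + 3 by rewrite /l -[in LHS]addn3 natrD.
rewrite -/n.
have m0 : 0 <= m%:R :> R by [].
have n0 : 0 <= n by [].
move: (m%:R : R) (pair_pmf0 R m N) (@pair_pmfS R m N) m0 @F
   => x Ew0 EwS x0 F.
elim: k => [_|k IH kN].
  rewrite /F big_geq// mul0r subr0 mul1r expr0 mulr1.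
  have -> : pair_pmf m N 0 = (x + 2) * (x + 1) / ((x + 2 + n) * (x + 1 + n)).
    by rewrite -Ew0 mulrC mulKf// mulf_neq0// gt_eqF//; lra.
  rewrite expr_div_n ler_pdivrMr ?mulr_gt0//; [|lra..].
  rewrite mulrAC ler_pdivlMr; last by rewrite exprn_gt0//; lra.
  by nra.
have {IH} IH := IH (ltnW kN).
have kn : 0 < n - k%:R by rewrite subr_gt0 ltr_nat.
have l0 : 0 < x + 3 + n by lra.
have w0 := pair_pmf_ge0 R m N k.+1.
have k0 : 0 <= k%:R :> R by [].
have n1 : 0 < n by lra.
have -> : F k.+1 = F k + Num.max 0 (3 - x * k%:R / n).
  by rewrite /F big_nat_recr.
set b := Num.max _ _.
have b0 : 0 <= b by rewrite le_max lexx.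
have b1 : 3 - x * k%:R / n <= b by rewrite le_max lexx orbT.
have f0 : 0 <= F k / (x + 3 + n).
  by rewrite divr_ge0 ?(ltW l0)// sumr_ge0// => i _; rewrite le_max lexx.
have g0 : 0 <= b / (x + 3 + n) by rewrite divr_ge0// ltW.
have g1 : (3 - x * k%:R / n) / (x + 3 + n) <= b / (x + 3 + n).
  by rewrite ler_wpM2r// invr_ge0 ltW.
rewrite [(F k + b) / _]mulrDl; move: f0 g0 g1 IH.
set f := F k / _; set g := b / _ => f0 g0 g1 IH.
(* If f > 1 then the left-hand side is nonpositive, and multiplying the
   induction hypothesis by a lower bound of the next factor would be wrong. *)
have [f1|f1] := leP f 1; last first.
  apply: (@le_trans _ _ 0).
    by rewrite mulr_le0_ge0//; lra.
  by rewrite mulr_ge0// ?exprn_ge0// divr_ge0//; lra.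
have q0 : 0 <= n / (x + 3 + n) by rewrite divr_ge0// ltW.
rewrite [_ ^+ k.+1]exprSr mulrA; apply: (le_trans _ (ler_wpM2r q0 IH)).
have wE : pair_pmf m N k = (x + n - k%:R) / (n - k%:R) * pair_pmf m N k.+1.
  by rewrite mulrAC EwS// mulrAC mulfV ?mul1r ?gt_eqF.
have step : 1 - g <= (x + n - k%:R) / (n - k%:R) * (n / (x + 3 + n)).
  have : 1 - (3 - x * k%:R / n) / (x + 3 + n) <=
      (x + n - k%:R) / (n - k%:R) * (n / (x + 3 + n)).
    rewrite -subr_ge0; set e := (X in 0 <= X).
    have -> : e = x * k%:R ^+ 2 / (n * (n - k%:R) * (x + 3 + n)).
      by rewrite /e; field; rewrite !gt_eqF.
    by rewrite divr_ge0 ?mulr_ge0// ?exprn_ge0// ltW.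
  by apply: le_trans; rewrite lerB.
rewrite (_ : (1 - f) * _ * _ = (1 - f) *
    ((x + n - k%:R) / (n - k%:R) * (n / (x + 3 + n))) * pair_pmf m N k.+1); last first.
  by rewrite wE; ring.
rewrite ler_wpM2r//; apply: (@le_trans _ _ ((1 - f) * (1 - g))); first by nra.
by rewrite ler_wpM2l// subr_ge0.
Qed.

(** The sum of the terms of positive index is at most the integral of the positive
    part of 3 - c t over the positive half-line, which is 9 / (2 c). The induction
    keeps track of the part of this integral that lies beyond k. *)
Lemma sum_max0_arith (R : realFieldType) (c : R) (k : nat) : 0 < c ->
  \sum_(0 <= i < k) Num.max 0 (3 - c * i%:R) <= 3 + 9 / (2 * c).
Proof.
move=> c0.
case: k => [|k]; first by rewrite big_geq// addr_ge0// divr_ge0// mulr_ge0// ltW.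
suff H : \sum_(0 <= i < k.+1) Num.max 0 (3 - c * i%:R) +
    Num.max 0 (3 - c * k%:R) ^+ 2 / (2 * c) <= 3 + 9 / (2 * c).
  apply: le_trans H; rewrite lerDl divr_ge0 ?sqr_ge0//; lra.
elim: k => [|k IH].
  rewrite big_nat1 mulr0 subr0 (max_idPr _)//; lra.
rewrite big_nat_recr//= -addrA; apply: le_trans IH; rewrite lerD2l.
have -> : 3 - c * k.+1%:R = 3 - c * k%:R - c by rewrite -natr1; ring.
set y := 3 - _.
rewrite -ler_pdivrMr ?invr_gt0//; last lra.
rewrite ?invrK mulrDl divfK; last lra.
have [y1|y1] := leP 0 (y - c).
  rewrite (@max_r _ _ 0 y); last lra.
  nra.
by rewrite expr0n mul0r add0r sqr_ge0.
Qed.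

Lemma pair_pmf0_le (R : realFieldType) (m N : nat) :
  pair_pmf m N 0 <= (m.+3%:R / (m.+3%:R + N%:R)) ^+ 2 :> R.
Proof.
have := @le_geometric_pair_pmf R m N 0 isT.
by rewrite big_geq// mul0r subr0 mul1r expr0 mulr1.
Qed.

(** Let L = m + 3. By le_geometric_pair_pmf, and sum_max0_arith with c = m / N,
    the relative excess is at most (3 + 9 N / (2 m)) / (L + N). This is at most 7 / L if m >= 6 because
    9 L / (2 m) <= 7, and if m = 5 because N is then at most 4; for m <= 4 the
    left-hand side is nonpositive. *)
Lemma pair_pmf_le (R : realFieldType) (m N k : nat) :
  let l : R := m.+3%:R in let n : R := N%:R in
  (0 < N)%N -> (14 * N <= m.+3 ^ 2)%N -> (k <= N)%N ->
  (1 - 7 / l) * pair_pmf m N k <= (l / (l + n)) ^+ 2 * (n / (l + n)) ^+ k.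
Proof.
move=> l n N0 Hm kN.
have [m4|m4] := leqP m 4.
  apply: (@le_trans _ _ 0).
    rewrite mulr_le0_ge0 ?pair_pmf_ge0// subr_le0 ler_pdivlMr ?ltr0n// mul1r.
    by rewrite /l ler_nat; lia.
  by rewrite mulr_ge0// exprn_ge0// divr_ge0// addr_ge0.
have n0 : 1 <= n by rewrite ler1n.
have x0 : 5 <= m%:R :> R by rewrite ler_nat.
have lE : l = m%:R + 3 by rewrite /l -[in LHS]addn3 natrD.
have := @le_geometric_pair_pmf R m N k kN; apply: le_trans.
rewrite ler_wpM2r ?pair_pmf_ge0// lerB// -/l -/n.
have c0 : 0 < m%:R / n by rewrite divr_gt0//; lra.
have := sum_max0_arith k c0.
under [in X in X -> _]eq_bigr do rewrite mulrAC.
set F := \sum_(_ <= _ < _) _ => FD.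
rewrite lE ler_pdivrMr ?(le_trans FD)//; last lra.
rewrite (_ : 9 / _ = 9 * n / (2 * m%:R)); last first.
  by field; rewrite !gt_eqF//; lra.
rewrite -subr_ge0; set e := (X in 0 <= X).
have -> : e = (8 * m%:R * (m%:R + 3) + 5 * n * m%:R - 27 * n) /
    (2 * m%:R * (m%:R + 3)).
  by rewrite /e; field; rewrite !gt_eqF//; lra.
apply: divr_ge0; last by rewrite !mulr_ge0//; lra.
have Hm' : 14 * n <= (m%:R + 3) ^+ 2.
  by move: Hm; rewrite -lE -(ler_nat R) natrM natrX.
nra.
Qed.

(** For a single particle this is an equality. *)
Lemma pair_pmf0_ge (R : realFieldType) (m N : nat) : (0 < N)%N ->
  1 - pair_pmf m N 0 <= 2 * N%:R / m.+3%:R :> R.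
Proof.
move=> N0.
have n0 : 1 <= N%:R :> R by rewrite ler1n.
have -> : m.+3%:R = m%:R + 3 :> R by rewrite -[in LHS]addn3 natrD.
have := pair_pmf0 R m N.
have : 0 <= m%:R :> R by [].
move: (pair_pmf _ _ _ : R) (m%:R : R) (N%:R : R) n0 => w x n n0 x0 E.
have M0 : 0 < (x + 2 + n) * (x + 1 + n) by rewrite mulr_gt0//; lra.
have -> : w = (x + 2) * (x + 1) / ((x + 2 + n) * (x + 1 + n)).
  by rewrite -E mulrC mulKf// gt_eqF.
rewrite -subr_ge0; set e := (X in 0 <= X).
have -> : e = n * ((3 * x + 3) * (n - 1) + 2 * (n ^+ 2 - 1)) /
    ((x + 3) * ((x + 2 + n) * (x + 1 + n))).
  by rewrite /e; field; rewrite !gt_eqF//; lra.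
rewrite divr_ge0 ?mulr_ge0//; try lra.
by rewrite addr_ge0// mulr_ge0//; try lra; rewrite subr_ge0 exprn_ege1.
Qed.

(** * Discrete probability measures *)

Lemma measurable_tuple_nat n (A : set (n.-tuple nat)) : measurable A.
Proof.
apply: countable_measurable => [t|]; last exact: countableP.
have -> : [set t] = \bigcap_(i in [set: 'I_n]) ((@tnth n nat)^~ i @^-1` [set tnth t i]).
  apply/seteqP; split => [_ -> //|s /= st].
  by apply: eq_from_tnth => i; exact: st.
apply: fin_bigcap_measurable => // i _.
by rewrite -[X in measurable X]setTI; exact: measurable_tnth.
Qed.

Lemma measurable_nat2 (A : set (nat * nat)) : measurable A.
Proof.
apply: countable_measurable => [[i j]|]; last exact: countableP.
have -> : [set (i, j)] = [set i] `*` [set j].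
  by apply/seteqP; split => [_ -> //|[a b] /= [-> ->]].
exact: measurableX.
Qed.

Lemma probability_setI_full d (T : measurableType d) (R : realType)
    (P : probability T R) (A S : set T) :
  measurable A -> measurable S -> P S = 1%E -> P A = P (A `&` S).
Proof.
move=> mA mS PS; rewrite (measureDI _ mA mS).
rewrite [X in (X + _)%E](_ : _ = 0%E) ?add0e//.
apply/eqP; rewrite eq_le measure_ge0 andbT.
have <- : P (~` S) = 0%E by rewrite probability_setC// PS subee.
apply: le_measure; rewrite ?inE; [exact: measurableD|exact: measurableC|].
by move=> x [].
Qed.

Lemma measure_fin_image d (T : measurableType d) (R : realType)
    (mu : {measure set T -> \bar R}) (I : finType) (D : {set I}) (f : I -> T)
    (c : R) :
  injective f -> (forall i, measurable [set f i]) ->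
  (forall i, i \in D -> mu [set f i] = c%:E) ->
  mu (f @` [set` D]) = (#|D|%:R * c)%:E.
Proof.
move=> inj_f mf muf; rewrite -bigcup_imset1 measure_fin_bigcup//; last first.
  by move=> i j _ _ [x [/= -> /inj_f ->]].
rewrite (eq_fsbigr (fun=> c%:E)); last by move=> i; rewrite inE => /muf.
rewrite -(bigfs _ (index_enum_uniq I)); last by move=> i; rewrite mem_index_enum.
by rewrite sumEFin sumr_const mulr_natl.
Qed.

(** Points other than o contribute at most c (f a) to the difference p A - q A,
    and o contributes nothing positive, so that the difference is at most c times
    the p-mass of the complement of o. The sums are finite as p lives on F. *)
Lemma tv_dist_le d (T : measurableType d) (R : realType)
    (p q : probability T R) (F : set T) (f g : T -> R) (o : T) (c : R) :
  (forall A : set T, measurable A) -> finite_set F -> p F = 1%E ->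
  (forall a, F a -> p [set a] = (f a)%:E) ->
  (forall a, F a -> q [set a] = (g a)%:E) ->
  F o -> f o <= g o -> 0 <= c -> (forall a, F a -> (1 - c) * f a <= g a) ->
  (tv_dist p q <= (c * (1 - f o))%:E)%E.
Proof.
move=> mT finF pF pf qg Fo fg0 c0 fg; apply: ge_ereal_sup => _ [A _ <-].
pose B := A `&` F `\ o.
have pB : ((1 - c)%:E * p B <= q B)%E.
  have finB : finite_set B by apply: sub_finite_set finF => x [[]].
  have BE : B = \bigcup_(a in B) [set a] by rewrite bigcup_imset1 image_id.
  rewrite BE !measure_fin_bigcup//; try by move=> a b _ _ [x [/= -> ->]].
  rewrite ge0_mule_fsumr//; apply: lee_fsum => // a [[_ Fa] _].
  by move: (fg a Fa); rewrite -lee_fin EFinM -pf// -qg.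
have pA : (p A <= p B + p (A `&` [set o]))%E.
  rewrite (probability_setI_full (mT A) (mT F) pF) -measureU//.
  - apply: le_measure; rewrite ?inE// => x [Ax Fx].
    have [xo|xo] := eqVneq x o; first by right.
    by left; split => //= /eqP; exact/negP.
  - by apply/seteqP; split => // x [[_ xo] [_ ]].
have qA : (q B + q (A `&` [set o]) <= q A)%E.
  rewrite -measureU//.
  - by apply: le_measure; rewrite ?inE// => x [[[]]|[]].
  - by apply/seteqP; split => // x [[_ xo] [_ ]].
have pqo : (p (A `&` [set o]) <= q (A `&` [set o]))%E.
  have [Ao|Ao] := pselect (A o).
    by rewrite (_ : A `&` _ = [set o]) ?pf ?qg//; apply/setIidPr => _ ->.
  by rewrite (_ : A `&` _ = set0) ?measure0//; apply/seteqP; split => // x [/[swap] -> /Ao].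
have pB1 : (p B <= 1 - p [set o])%E.
  rewrite -probability_setC//; apply: le_measure; rewrite ?inE// => x [].
  by [].
have pfin X : p X = (fine (p X))%:E by rewrite fineK// fin_num_measure.
have qfin X : q X = (fine (q X))%:E by rewrite fineK// fin_num_measure.
move: pB pA qA pqo pB1; rewrite pf// (pfin A) (pfin B)
  (pfin (A `&` _)) (qfin A) (qfin B) (qfin (A `&` _)) -?EFinD -?EFinB -?EFinM !lee_fin => *.
nra.
Qed.

(** * The law of two sites *)

Section bose_einstein_counts.
Context (R : realType) (d : measure_display) (T : measurableType d).
Context (P : probability T R).

Let tnats n N (t : n.-tuple 'I_N.+1) : n.-tuple nat := [tuple of map val t].

Let tnats_inj n N : injective (@tnats n N).
Proof.
move=> s t /(congr1 val)/= st; apply/val_inj/(inj_map val_inj)/st.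
Qed.

(** Each entry of a tuple of sum N is at most N, so that the tuples to be counted
    are tuples over a finite type. *)
Lemma image_ord_tuple n N :
  [set x : n.-tuple nat | (\sum_(i < n) tnth x i = N)%N] =
  (@tnats n N) @` [set` [set t : n.-tuple 'I_N.+1 | (\sum_(i <- t) i == N)%N]%SET].
Proof.
apply/seteqP; split=> [x /= xN|_ [t /= + <-]]; last first.
  rewrite inE big_tuple => /eqP tN; rewrite -[RHS]tN.
  by apply: eq_bigr => i _; rewrite tnth_map.
have xi i : (tnth x i < N.+1)%N by rewrite -xN ltnS (bigD1 i)//= leq_addr.
exists [tuple Ordinal (xi i) | i < n].
  by rewrite /= inE big_tuple -[X in _ == X]xN; apply/eqP/eq_bigr => i _; rewrite tnth_mktuple.
by apply: eq_from_tnth => i; rewrite tnth_map tnth_mktuple.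
Qed.

(** With f the identity this gives the total mass of the configurations with N
    particles, and with f prepending i and j it gives the law of two sites. *)
Lemma bose_einstein_image L N (X : {RV P >-> L.-tuple nat}) n M
    (f : n.+1.-tuple nat -> L.-tuple nat) :
  bose_einstein P N X -> injective f ->
  (forall x, \sum_(i < n.+1) tnth x i = M -> \sum_(i < L) tnth (f x) i = N)%N ->
  distribution P X (f @` [set x | (\sum_(i < n.+1) tnth x i = M)%N]) =
  ('C(n + M, n)%:R / 'C(L + N - 1, N)%:R)%:E.
Proof.
move=> hX inj_f fN; rewrite image_ord_tuple image_comp.
rewrite (@measure_fin_image _ _ _ _ _ _ _ ('C(L + N - 1, N)%:R^-1)).
- by rewrite card_ord_partitions.
- by move=> s t /= /inj_f /tnats_inj.
- by move=> t; exact: measurable_tuple_nat.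
- move=> t; rewrite inE => tM; apply: (etrans (hX (f (tnats t)))).
  rewrite fN ?eqxx//.
  suff : [set x : n.+1.-tuple nat | (\sum_(i < n.+1) tnth x i = M)%N] (tnats t) by [].
  by rewrite image_ord_tuple; exists t => //=; rewrite inE.
Qed.

End bose_einstein_counts.

Section pair_distribution.
Context (R : realType) (d : measure_display) (T : measurableType d).
Context (P : probability T R) (m N : nat) (hL : (2 <= m.+3)%N).
Context (X : {RV P >-> m.+3.-tuple nat}) (hX : bose_einstein P N X).

Let X12 := coord_pair X (Ordinal (ltnW hL)) (Ordinal hL).
Let S := [set x : m.+3.-tuple nat | (\sum_(i < m.+3) tnth x i = N)%N].

Let binE : ('C(m.+3 + N - 1, N) = 'C(m.+2 + N, m.+2))%N.
Proof. by rewrite addSn subn1/= -[RHS]bin_sub ?leq_addr// addKn. Qed.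

(** The configurations with N particles are the only ones of positive mass because
    their number is the normalizing constant. *)
Lemma bose_einstein_total : distribution P X S = 1%E.
Proof.
have := @bose_einstein_image R d T P _ N X m.+2 N idfun hX (@inj_id _) (fun _ => id).
rewrite image_id => ->.
by rewrite binE divff// pnatr_eq0 -lt0n bin_gt0 leq_addr.
Qed.

Lemma distribution_pair i j : (i + j <= N)%N ->
  distribution P X12 [set (i, j)] = (pair_pmf m N (i + j))%:E.
Proof.
move=> ijN.
pose f (t : m.+1.-tuple nat) : m.+3.-tuple nat := [tuple of i :: j :: t].
have inj_f : injective f.
  by move=> s t /(congr1 val)/= [st]; exact: val_inj.
have sum_f t : (\sum_(k < m.+3) tnth (f t) k = i + j + \sum_(k < m.+1) tnth t k)%N.
  rewrite [LHS]big_ord_recl [X in (_ + X = _)%N]big_ord_recl addnA; congr (_ + _ + _)%N.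
  by apply: eq_bigr => k _; rewrite !(tnth_nth 0%N).
transitivity (distribution P X [set x : m.+3.-tuple nat |
    (tnth x (Ordinal (ltnW hL)), tnth x (Ordinal hL)) = (i, j)]); first by [].
have mT (A : set (m.+3.-tuple nat)) : measurable A := measurable_tuple_nat A.
rewrite (probability_setI_full (mT _) (mT _) bose_einstein_total).
rewrite (_ : _ `&` _ =
    f @` [set t | (\sum_(k < m.+1) tnth t k = N - (i + j))%N]); last first.
  apply/seteqP; split=> [x [/= [xi xj]]|_ [t /= tN <-]]; last first.
    by rewrite /S/= sum_f tN subnKC.
  case/tupleP: x xi xj => a x; case/tupleP: x => b x.
  rewrite !(tnth_nth 0%N)/= => -> -> xN.
  exists x; last exact: val_inj.
  by move: xN; rewrite /S/= (sum_f x) => <-; rewrite addKn.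
apply: (etrans (bose_einstein_image hX inj_f _)); last by rewrite binE.
by move=> t tN; rewrite sum_f tN subnKC.
Qed.

Lemma distribution_pair_support :
  distribution P X12 [set ij | (ij.1 + ij.2 <= N)%N] = 1%E.
Proof.
have mF := measurable_nat2 [set ij | (ij.1 + ij.2 <= N)%N].
apply/eqP; rewrite eq_le probability_le1//= -bose_einstein_total.
have -> : distribution P X12 [set ij | (ij.1 + ij.2 <= N)%N] =
    distribution P X [set x | (tnth x (Ordinal (ltnW hL)) + tnth x (Ordinal hL) <= N)%N].
  by [].
apply: le_measure; rewrite ?inE; [exact: measurable_tuple_nat..|].
move=> x; rewrite /S/= => <-.
rewrite (bigD1 (Ordinal (ltnW hL)))// (bigD1 (Ordinal hL))//=.
by rewrite addnA leq_addr.
Qed.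

End pair_distribution.

(** * Comparison with the product of geometric laws *)

Lemma geometric_prob1 (R : realType) (p : R) k : 0 < p <= 1 ->
  geometric_prob p [set k] = (p * (1 - p) ^+ k)%:E.
Proof.
move=> p01; rewrite /geometric_prob p01 esum_set1//.
by case/andP: p01 => p0 p1; rewrite lee_fin mulr_ge0 ?exprn_ge0 ?subr_ge0// ltW.
Qed.

Lemma geometric_prod1 (R : realType) (l n : R) i j : 0 < l -> 0 <= n ->
  let lambda := geometric_prob (1 / (1 + n / l)) in
  (lambda \x lambda)%E [set (i, j)] =
  ((l / (l + n)) ^+ 2 * (n / (l + n)) ^+ (i + j))%:E.
Proof.
move=> l0 n0 lambda.
have ln0 : 0 < l + n by rewrite ltr_wpDr.
have -> : [set (i, j)] = [set i] `*` [set j].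
  by apply/seteqP; split => [_ -> //|[a b] /= [-> ->]].
transitivity (lambda [set i] * lambda [set j])%E.
  exact: product_measure1E.
rewrite /lambda.
have -> : 1 / (1 + n / l) = l / (l + n).
  by field; rewrite !gt_eqF.
have p01 : 0 < l / (l + n) <= 1.
  by rewrite divr_gt0//= ler_pdivrMr// mul1r lerDl.
rewrite !geometric_prob1//.
have -> : 1 - l / (l + n) = n / (l + n) by field; rewrite gt_eqF.
by rewrite -EFinM exprD; congr _%:E; ring.
Qed.

Theorem theorem3p5 (R : realType) (d : measure_display) (T : measurableType d)
    (P : probability T R) (L N : nat) (hL : (2 <= L)%N) (hN : (1 <= N)%N)
    (X : {RV P >-> L.-tuple nat}) (hX : bose_einstein P N X) :
  let X12 := coord_pair X (Ordinal (ltnW hL)) (Ordinal hL) in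
  let gamma := distribution P X12 in
  let lambda := geometric_prob (1 / (1 + N%:R / L%:R) : R) in
  (tv_dist gamma (lambda \x lambda)%E <= (14 * N%:R / L%:R ^+ 2)%:E)%E.
Proof.
have [Nbig|Nsmall] := leqP (L ^ 2) (14 * N).
  lazy zeta; apply: ge_ereal_sup => _ [A _ <-].
  apply: (@le_trans _ _ (1%:E)).
    rewrite leeBlDr; last by rewrite fin_num_measure//; exact: measurable_nat2.
    apply: (le_trans (probability_le1 _ (measurable_nat2 A))).
    by rewrite leeDl.
  rewrite lee_fin ler_pdivlMr ?exprn_gt0 ?ltr0n 1?ltnW// mul1r.
  by rewrite -natrX -natrM ler_nat.
have L3 : (3 <= L)%N.
  by rewrite ltnNge; apply/negP => L2; have := leq_sqr L 2; rewrite L2; lia.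
case: L => [|[|[|m]]]// in hL X hX Nsmall L3 *.
lazy zeta; set gamma := distribution P _.
apply: (@le_trans _ _ (7 / m.+3%:R * (1 - pair_pmf m N 0))%:E).
  apply: (@tv_dist_le _ _ _ _ _ [set ij | (ij.1 + ij.2 <= N)%N]
    (fun ij => pair_pmf m N (ij.1 + ij.2))
    (fun ij => (m.+3%:R / (m.+3%:R + N%:R)) ^+ 2 *
               (N%:R / (m.+3%:R + N%:R)) ^+ (ij.1 + ij.2)) (0, 0)%N).
  - exact: measurable_nat2.
  - apply: (@sub_finite_set _ _ (`I_N.+1 `*` `I_N.+1)); last exact: finite_setX.
    by move=> [i j] /= ijN; split => /=; lia.
  - exact: distribution_pair_support.
  - by move=> [i j] /= ijN; exact: distribution_pair.
  - by move=> [i j] /= ijN; exact: geometric_prod1.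
  - by [].
  - by rewrite expr0 mulr1 pair_pmf0_le.
  - by rewrite divr_ge0.
  - by move=> [i j] /= ijN; rewrite pair_pmf_le// ltnW.
rewrite lee_fin; apply: (@le_trans _ _ (7 / m.+3%:R * (2 * N%:R / m.+3%:R))).
  by rewrite ler_wpM2l ?divr_ge0// pair_pmf0_ge.
have : m.+3%:R != 0 :> R by rewrite pnatr_eq0.
by move: (m.+3%:R : R) => l l0; rewrite le_eqVlt; apply/orP; left; apply/eqP; field.
Qed.
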